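(* For every integer $n\ge 4$, let $(\beta_M-\beta_E)(n)$ denote the maximum of $\beta_M(G)-\beta_E(G)$ over all connected graphs $G$ of order $n$. Then $$\left\lfloor \tfrac{n}{2}\right\rfloor-1\le (\beta_M-\beta_E)(n)\le n-2.$$
   Context: All graphs are simple, undirected, finite and connected; $d(u,v)$ is the shortest-path distance between vertices $u,v$. For an edge $uv$ and a vertex $w$, $d(uv,w)=\min\{d(u,w),d(v,w)\}$. A vertex $w$ resolves two items $a,b$ (vertices or edges) if $d(a,w)\neq d(b,w)$. A vertex set $S\subseteq V(G)$ is an edge resolving set if every two distinct edges of $G$ are resolved by some vertex of $S$; the edge metric dimension $\beta_E(G)$ is the minimum cardinality of an edge resolving set. $S$ is a mixed resolving set if every two distinct elements of $V(G)\cup E(G)$ are resolved by some vertex of $S$; the mixed metric dimension $\beta_M(G)$ is the minimum cardinality of a mixed resolving set. *)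

(* Defs.v *)
From mathcomp Require Import all_boot all_order all_algebra.
Set Implicit Arguments.
Unset Strict Implicit.
Unset Printing Implicit Defensive.

Record sgraph := SGraph {
  vertex :> finType;
  adj : rel vertex;
  adj_sym : symmetric adj;
  adj_irr : irreflexive adj }.

Section Graph.
Variable G : sgraph.
Implicit Types (u v w : G) (e f : {set G}) (S : {set G}).

Definition connected : bool := [forall u : G, forall v : G, connect (@adj G) u v].

Definition edges : {set {set G}} :=
  [set [set p.1; p.2] | p : G * G & adj p.1 p.2].

Definition has_walk u v (k : nat) : bool :=
  [exists p : k.-tuple G, path (@adj G) u p && (last u p == v)].

(* The least length of a walk from u to v.  A shortest walk has fewer than    *)
(* #|G| edges; the value is #|G| when v is not reachable from u.              *)
Definition dist u v : nat := find (has_walk u v) (iota 0 #|G|).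

(* The default #|G| of the iterated minimum is neutral: see edistE.           *)
Definition edist e w : nat := \big[minn/#|G|]_(u in e) dist u w.

(* Items: inl v is the vertex v, inr e is the edge e (when e \in edges).      *)
Definition elements : {set G + {set G}} :=
  [set x | if x is inr e then e \in edges else true].

Definition item_dist (x : G + {set G}) w : nat :=
  match x with inl v => dist v w | inr e => edist e w end.

Definition resolves w (x y : G + {set G}) : bool := item_dist x w != item_dist y w.

Definition edge_resolving S : bool :=
  [forall e in edges, forall f in edges,
     (e != f) ==> [exists w in S, resolves w (inr e) (inr f)]].

Definition mixed_resolving S : bool :=
  [forall x in elements, forall y in elements,
     (x != y) ==> [exists w in S, resolves w x y]].

(* The whole vertex set qualifies in both cases (edge_resolvingT and          *)
(* mixed_resolvingT), so both minima are over nonempty families.              *)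
Definition edge_dim : nat :=
  #|[arg min_(S < [set: G] | edge_resolving S) #|S| ]|.
Definition mixed_dim : nat :=
  #|[arg min_(S < [set: G] | mixed_resolving S) #|S| ]|.

Definition dim_gap : int := (mixed_dim%:Z - edge_dim%:Z)%R.

Lemma has_walkP u v k :
  reflect (exists p, [/\ size p = k, path (@adj G) u p & last u p = v])
          (has_walk u v k).
Proof.
apply: (iffP existsP) => [[p /andP[pp /eqP lp]]|[p [sp pp lp]]].
  by exists p; rewrite size_tuple.
by exists (tcast sp (in_tuple p)); rewrite val_tcast /= pp lp eqxx.
Qed.

Lemma dist_leG u v : dist u v <= #|G|.
Proof. by rewrite -[leqRHS](size_iota 0) find_size. Qed.

Lemma dist_walk u v : connect (@adj G) u v -> has_walk u v (dist u v).
Proof.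
case/connectP=> p0 p0P; have [p pp up _ lp] := shortenP p0P.
have ltp : size p < #|G| by rewrite -[_.+1]/(size (u :: p)) -(card_uniqP up) max_card.
have hw : has (has_walk u v) (iota 0 #|G|).
  apply/hasP; exists (size p); first by rewrite mem_iota.
  by apply/has_walkP; exists p; rewrite lp.
have := nth_find 0 hw; rewrite nth_iota //.
by move: hw; rewrite has_find size_iota.
Qed.

Lemma dist_min u v k : has_walk u v k -> dist u v <= k.
Proof.
move=> hk; rewrite leqNgt; apply/negP=> lt_k.
have ltG : k < #|G| := leq_trans lt_k (dist_leG u v).
by have := before_find 0 lt_k; rewrite nth_iota // add0n hk.
Qed.

Lemma dist_eq0 u v : (dist u v == 0) = (u == v).
Proof.
apply/idP/eqP => [/eqP d0|->]; last first.
  by rewrite -leqn0; apply: dist_min; apply/has_walkP; exists [::].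
have Gpos : 0 < #|G| by apply/card_gt0P; exists u.
have hw : has (has_walk u v) (iota 0 #|G|).
  by rewrite has_find size_iota -/(dist u v) d0.
have := nth_find 0 hw; rewrite -/(dist u v) d0 nth_iota //.
by case/has_walkP=> p [/size0nil -> _ /=].
Qed.

Lemma edgesP e : reflect (exists u v, adj u v /\ e = [set u; v]) (e \in edges).
Proof.
apply: (iffP imsetP) => [[[u v] /= uv ->]|[u [v [uv ->]]]].
  by exists u, v; rewrite inE in uv.
by exists (u, v); rewrite ?inE.
Qed.

Lemma leq_edist e w k : k <= #|G| ->
  (k <= edist e w) = [forall u in e, k <= dist u w].
Proof.
move=> kG; have morphk : {morph leq k : x y / minn x y >-> x && y}.
  by move=> x y; rewrite leq_min.
by rewrite /edist (big_morph (leq k) morphk kG) big_andE.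
Qed.

Lemma edistE u v w : adj u v -> edist [set u; v] w = minn (dist u w) (dist v w).
Proof.
move=> uv; have leG : edist [set u; v] w <= #|G|.
  rewrite /edist; elim/big_ind: _ => [//|x y xG _|x _]; last exact: dist_leG.
  by rewrite geq_min xG.
apply/eqP; rewrite eqn_leq; apply/andP; split; last first.
  rewrite leq_edist; last by rewrite geq_min dist_leG.
  by apply/forall_inP=> x /set2P[] ->; rewrite geq_min leqnn ?orbT.
have := leqnn (edist [set u; v] w); rewrite leq_edist // => /forall_inP H.
by rewrite leq_min !H // !inE eqxx ?orbT.
Qed.

Lemma edist_eq0 e w : e \in edges -> (edist e w == 0) = (w \in e).
Proof.
case/edgesP=> u [v [uv ->]]; rewrite edistE // -leqn0 geq_min !leqn0 !dist_eq0.
by rewrite !inE ![w == _]eq_sym.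
Qed.

Lemma edges_card e : e \in edges -> #|e| = 2.
Proof.
case/edgesP=> u [v [uv ->]]; rewrite cards2.
by have -> : u != v by apply: contraTneq uv => ->; rewrite adj_irr.
Qed.

Definition item_set (x : G + {set G}) : {set G} :=
  match x with inl v => [set v] | inr e => e end.

Lemma item_dist_eq0 x w : x \in elements -> (item_dist x w == 0) = (w \in item_set x).
Proof.
rewrite inE; case: x => [v _|e]; last exact: edist_eq0.
by rewrite /= dist_eq0 inE eq_sym.
Qed.

Lemma mixed_resolvingT : mixed_resolving [set: G].
Proof.
apply/forall_inP=> x xE; apply/forall_inP=> y yE; apply/implyP=> neq.
have sneq : item_set x != item_set y.
  apply: contraNN neq; move: xE yE; rewrite !inE.
  case: x y => [v|e] [v'|e'] /= xE yE /eqP E.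
  - by move/set1_inj: E => ->.
  - by have := edges_card yE; rewrite -E cards1.
  - by have := edges_card xE; rewrite E cards1.
  - by rewrite E.
have [w wP] : exists w, (w \in item_set x) != (w \in item_set y).
  apply/existsP; apply: contraNT sneq => /existsPn H.
  by apply/eqP/setP=> w; apply/eqP; rewrite -[_ == _]negbK H.
apply/exists_inP; exists w; first by rewrite inE.
by apply: contraNneq wP => E; rewrite -!item_dist_eq0 // E.
Qed.

Lemma mixed_edge_resolving S : mixed_resolving S -> edge_resolving S.
Proof.
move=> /forall_inP H; apply/forall_inP=> e eE; apply/forall_inP=> f fE.
apply/implyP=> neq; have /forall_inP /(_ (inr f)) := H (inr e) ltac:(by rewrite inE).
rewrite inE fE => /(_ isT) /implyP; apply.
by apply: contraNneq neq => -[->].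
Qed.

Lemma edge_resolvingT : edge_resolving [set: G].
Proof. exact: mixed_edge_resolving mixed_resolvingT. Qed.

End Graph.

Definition is_max_dim_gap (n : nat) (m : int) : Prop :=
  (exists G : sgraph, [/\ #|G| = n, connected G & dim_gap G = m]) /\
  (forall G : sgraph, #|G| = n -> connected G -> (dim_gap G <= m)%R).

(* Main.v *)
Require Import Defs.
From mathcomp Require Import all_boot all_order all_algebra.
From mathcomp Require Import zify.
From Stdlib Require Import Classical.

(** Lower bound: in a caterpillar whose spine vertices 1, ..., k-1 each carry
    one pendant vertex, every leaf lies in every mixed resolving set (a leaf is
    the only vertex separating its neighbour from its edge), while the two ends
    of the spine alone resolve all edges.  With k = n/2 there are k+1 leaves.

    Upper bound: as the mixed dimension is at most n, only edge dimension at
    most 1 matters.  If {w} resolves the edges, then w is a leaf, and deleting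
    the neighbour u of w from the vertex set leaves a mixed resolving set. *)

(** * Dimensions as minima; distances and connectedness *)

Section Dimension.
Variable G : sgraph.
Implicit Types (u v w x y z : G) (S A e : {set G}).

Lemma mixed_dim_le S : mixed_resolving S -> mixed_dim G <= #|S|.
Proof.
rewrite /mixed_dim; case: arg_minnP => [|T _ minT]; first exact: mixed_resolvingT.
exact: minT.
Qed.

Lemma edge_dim_le S : edge_resolving S -> edge_dim G <= #|S|.
Proof.
rewrite /edge_dim; case: arg_minnP => [|T _ minT]; first exact: edge_resolvingT.
exact: minT.
Qed.

Lemma mixed_dim_witness : exists2 S : {set G}, mixed_resolving S & #|S| = mixed_dim G.
Proof.
rewrite /mixed_dim; case: arg_minnP => [|S HS _]; first exact: mixed_resolvingT.
by exists S.
Qed.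

Lemma edge_dim_witness : exists2 S : {set G}, edge_resolving S & #|S| = edge_dim G.
Proof.
rewrite /edge_dim; case: arg_minnP => [|S HS _]; first exact: edge_resolvingT.
by exists S.
Qed.

Lemma adj_neq x y : adj x y -> x != y.
Proof. by apply: contraTneq => ->; rewrite adj_irr. Qed.

Lemma edge_in x y : adj x y -> [set x; y] \in edges G.
Proof. by move=> xy; apply/edgesP; exists x, y. Qed.

Lemma dist_adj x y : adj x y -> dist x y = 1.
Proof.
move=> xy; apply/eqP; rewrite eqn_leq lt0n dist_eq0 adj_neq // andbT.
by apply: dist_min; apply/has_walkP; exists [:: y]; rewrite /= xy.
Qed.

Lemma connectedP x y : connected G -> connect (@adj G) x y.
Proof. by move/forallP/(_ x)/forallP/(_ y). Qed.

Lemma dist_eq1 x y : connected G -> (dist x y == 1) = adj x y.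
Proof.
move=> Gc; apply/eqP/idP => [d1|]; last exact: dist_adj.
have := dist_walk (connectedP x y Gc); rewrite d1.
by case/has_walkP => [[|z [|? ?]] [] //= _ /andP[xz _] <-].
Qed.

(** Take the first step of a path from [x] to [y] that leaves [A]. *)
Lemma boundary_edge A x y : connected G -> x \in A -> y \notin A ->
  exists u v, [/\ u \in A, v \notin A & adj u v].
Proof.
move=> Gc xA yA; case/connectP: (connectedP x y Gc) => p.
elim: p x xA => [|z p IH] x xA /=; first by move=> _ yx; rewrite yx xA in yA.
case/andP=> xz zp yl; have [zA|zA] := boolP (z \in A); first exact: IH zA zp yl.
by exists x, z.
Qed.

(** A certificate for distances: descending along [f] yields a walk to [w] of length at most [f x],
    while [f] drops by at most one per step, so no walk is shorter. Connectivity comes as a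
    by-product. *)
Lemma dist_of_descent (f : G -> nat) w : f w = 0 ->
  (forall x y, adj x y -> f x <= (f y).+1) ->
  (forall x, x != w -> exists2 y, adj x y & f y < f x) ->
  forall x, connect (@adj G) x w /\ dist x w = f x.
Proof.
move=> fw lip desc x.
have walk m : forall y, f y <= m ->
    exists p, [/\ size p <= m, path (@adj G) y p & last y p = w].
  elim: m => [|m IH] y fy; have [->|yw] := eqVneq y w; try by exists [::].
    by have [z _] := desc _ yw; rewrite ltnNge (leq_trans fy).
  have [z yz fzy] := desc _ yw.
  have [|p [sp pp lp]] := IH z; first by lia.
  by exists (z :: p); split; rewrite //= yz.
have [p [sp pp lp]] := walk _ _ (leqnn (f x)).
have conn : connect (@adj G) x w by apply/connectP; exists p.
split=> //; apply/eqP; rewrite eqn_leq; apply/andP; split.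
  by apply: leq_trans sp; apply: dist_min; apply/has_walkP; exists p.
case/has_walkP: (dist_walk conn) => q [<-] {p sp pp lp conn}.
elim: q x => [|y q IH] x /=; first by move=> _ ->; rewrite fw.
case/andP => xy yq lq; have := lip _ _ xy; have := IH _ yq lq; lia.
Qed.

Lemma connected_of_root w : (forall x, connect (@adj G) x w) -> connected G.
Proof.
move=> toW; apply/forallP=> x; apply/forallP=> y.
by apply: connect_trans (toW x) _; rewrite (sym_connect_sym (@adj_sym G)).
Qed.

(** * Vertices forced into, or removable from, mixed resolving sets *)

(** A walk from the leaf [x] to any other vertex [w] goes through [v] first, so [v] is the end of
    the edge nearer to [w], and [w] cannot tell [v] from the edge. *)
Lemma leaf_in_mixed_resolving S x v : connected G -> mixed_resolving S ->
  adj x v -> (forall y, adj x y -> y = v) -> x \in S.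
Proof.
move=> Gc HS xv leaf; apply: contraT => xS.
have/forall_inP/(_ (inl v)) H := HS.
have /forall_inP/(_ (inr [set x; v])) := H ltac:(by rewrite inE).
rewrite inE edge_in // => /(_ isT)/implyP/(_ isT)/exists_inP[w wS].
rewrite /resolves /= edistE // => /eqP[]; apply/esym/minn_idPr.
case/has_walkP: (dist_walk (connectedP x w Gc)) => [[|y p]] /= [<-].
  by move=> _ xw; rewrite xw wS in xS.
case/andP => /leaf -> vp lp; apply: leqW; apply: dist_min.
by apply/has_walkP; exists p.
Qed.

(** Items whose vertex sets differ at some [z] other than [x] are resolved by [z], at distance 0
    from exactly one of them. The only pairs left are a neighbour [v] of [x] and the edge [xv]; the
    hypothesis provides a vertex nearer to [x], hence to the edge, than to [v]. *)
Lemma mixed_resolving_setC1 x :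
  (forall v, adj x v -> exists2 z, z != x & dist x z < dist v z) ->
  mixed_resolving [set~ x].
Proof.
move=> nomax.
have sep a b z : a \in elements G -> b \in elements G -> z != x ->
    (z \in item_set a) != (z \in item_set b) ->
    [exists w in [set~ x], resolves w a b].
  move=> aE bE zx zab; apply/exists_inP; exists z; first by rewrite !inE.
  by apply: contraNneq zab => E; rewrite -!item_dist_eq0 // E.
have vertex_edge v e : e \in edges G ->
    [exists w in [set~ x], resolves w (inl v) (inr e)].
  move=> eE; have eE' : inr e \in elements G by rewrite inE.
  have vE : inl v \in elements G by rewrite inE.
  have [/exists_inP[z]|] := boolP
    [exists z in [set~ x], (z \in item_set (inl v)) != (z \in item_set (inr e))].
    by rewrite in_setC1; apply: sep.
  rewrite negb_exists_in => /forall_inP agree.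
  have {}agree z : z != x -> (z == v) = (z \in e).
    by move=> zx; have := agree z; rewrite !inE negbK => /(_ zx)/eqP.
  (* An edge avoiding [x] would have both its ends equal to [v]. *)
  have [u xu eu] : exists2 u, adj x u & e = [set x; u].
    case/edgesP: eE agree => p [q [pq ->]] agree.
    have [px|px] := eqVneq p x; first by exists q; rewrite -px.
    have [qx|qx] := eqVneq q x.
      by exists p; rewrite -?qx 1?adj_sym // setUC.
    have := agree p px; have := agree q qx; rewrite !inE !eqxx orbT.
    by move=> /eqP qv /eqP pv; rewrite pv qv adj_irr in pq.
  have uv : u = v.
    apply/eqP; rewrite agree ?eu ?inE ?eqxx ?orbT //.
    by rewrite eq_sym adj_neq.
  have [z zx dz] := nomax u xu.
  apply/exists_inP; exists z; first by rewrite !inE.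
  by rewrite /resolves /= eu edistE // -uv; lia.
apply/forall_inP=> a aE; apply/forall_inP=> b bE; apply/implyP=> neq.
case: a b aE bE neq => [v|e] [v'|e'] aE bE neq.
- have {}neq : v != v' by apply: contraNneq neq => ->.
  have [vx|vx] := eqVneq v x.
    apply: (sep _ _ v') => //=; first by rewrite -vx eq_sym.
    by rewrite !inE eqxx [v' == v]eq_sym (negbTE neq).
  by apply: (sep _ _ v) => //=; rewrite !inE eqxx (negbTE neq).
- by apply: vertex_edge; rewrite inE in bE.
- rewrite inE in aE; have /exists_inP[w wS rw] := vertex_edge v' _ aE.
  by apply/exists_inP; exists w => //; rewrite /resolves eq_sym.
- have [/exists_inP[z]|] := boolP
    [exists z in [set~ x], (z \in item_set (inr e)) != (z \in item_set (inr e'))].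
    by rewrite in_setC1; apply: sep.
  rewrite negb_exists_in => /forall_inP agree.
  have {}agree z : z != x -> (z \in e) = (z \in e').
    by move=> zx; have := agree z; rewrite !inE negbK => /(_ zx)/eqP.
  have agreeD : e :\ x = e' :\ x.
    by apply/setP=> z; rewrite !inE; case: eqVneq => //= /agree.
  rewrite !inE in aE bE.
  (* Both edges have two vertices, so agreement away from [x] forces agreement at [x]. *)
  have := edges_card aE; rewrite (cardsD1 x) agreeD.
  have := edges_card bE; rewrite (cardsD1 x) => c1 c2.
  have agreex : (x \in e) = (x \in e') by lia.
  case/eqP: neq; congr inr; apply/setP=> z.
  by have [->|/agree] := eqVneq z x.
Qed.

(** * The upper bound *)

Lemma edge_resolving_sub S A : S \subset A -> edge_resolving S -> edge_resolving A.
Proof.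
move=> /subsetP sSA /forall_inP H; apply/forall_inP=> e eE; apply/forall_inP=> f fE.
apply/implyP=> neq; have /forall_inP/(_ f fE)/implyP/(_ neq) := H e eE.
by case/exists_inP=> w wS rw; apply/exists_inP; exists w; rewrite ?sSA.
Qed.

Lemma mixed_dim_le_card : mixed_dim G <= #|G|.
Proof. by rewrite -cardsT; apply/mixed_dim_le/mixed_resolvingT. Qed.

Lemma dim_gap_upper : connected G -> 2 < #|G| -> mixed_dim G + 2 <= #|G| + edge_dim G.
Proof.
move=> Gc n2; have mle := mixed_dim_le_card.
have [e2|e1] := leqP 2 (edge_dim G); first by lia.
have [S HS cS] := edge_dim_witness.
(* Enlarging [S] to a singleton treats the empty set at the same time. *)
have [w Sw] : exists w, S \subset [set w].
  have [w0 _] : exists w0, w0 \in [set: G] by apply/card_gt0P; rewrite cardsT; lia.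
  have [->|[w wS]] := set_0Vmem S; first by exists w0; rewrite sub0set.
  exists w; apply/subsetP=> z zS; rewrite inE; apply: contraTT e1 => zw.
  rewrite -leqNgt -cS -[2]/(true.+1) -zw -cards2 subset_leq_card //.
  by apply/subsetP=> t /set2P[] ->.
have Hw := edge_resolving_sub _ _ Sw HS.
have outside A : #|A| < #|G| -> exists y, y \notin A.
  move=> cA; have : 0 < #|~: A| by rewrite -(cardsC A) in cA; lia.
  by case/card_gt0P => y; rewrite inE; exists y.
have [y yw] : exists y, y \notin [set w] by apply: outside; rewrite cards1; lia.
have [w' [u [/set1P -> uw wu]]] := boundary_edge _ w y Gc (set11 w) yw.
(* Two edges at [w] would both be at distance 0 from [w]. *)
have leaf v : adj w v -> v = u.
  move=> wv; apply/eqP; apply: contraT => vu.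
  have neq : [set w; u] != [set w; v].
    apply: contraNneq vu => E; have : v \in [set w; u] by rewrite E set22.
    by rewrite !inE eq_sym (negbTE (adj_neq _ _ wv)).
  have /forall_inP/(_ _ (edge_in _ _ wu)) := Hw.
  move=> /forall_inP/(_ _ (edge_in _ _ wv))/implyP/(_ neq)/exists_inP[w0 /set1P ->].
  have d0 z : adj w z -> edist [set w; z] w = 0.
    by move=> wz; apply/eqP; rewrite edist_eq0 ?edge_in // set21.
  by rewrite /resolves /= !d0.
(* A third vertex and connectedness give a second neighbour [z] of [u], as the leaf [w] has no other
   neighbour. *)
have [y' yA] : exists y', y' \notin [set w; u].
  by apply: outside; rewrite cards2; case: (w != u); lia.
have [t [z [tA zA tz]]] := boundary_edge _ w y' Gc (set21 w u) yA.
move: zA; rewrite !inE negb_or => /andP[zw zu].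
have {tA tz} uz : adj u z.
  by case/set2P: tA tz => ->  // /leaf E; rewrite E eqxx in zu.
have far v : v != w -> v != u -> 1 < dist v w.
  move=> vw vu; rewrite ltn_neqAle eq_sym dist_eq1 // lt0n dist_eq0 vw andbT.
  by rewrite adj_sym; apply: contraNN vu => /leaf ->.
have uw1 : dist u w = 1 by apply: dist_adj; rewrite adj_sym.
(* For the neighbour [w] of [u] the nearer witness is [z]; for every other neighbour it is [w]. *)
have mix : mixed_resolving [set~ u].
  apply: mixed_resolving_setC1 => v uv.
  have [->|vw] := eqVneq v w.
    exists z => //; rewrite (dist_adj _ _ uz) ltn_neqAle eq_sym dist_eq1 //.
    rewrite lt0n dist_eq0 eq_sym zw andbT.
    by apply: contraNN zu => /leaf ->.
  exists w; first by rewrite adj_neq.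
  by rewrite uw1 far // eq_sym adj_neq.
(* The distinct edges [wu] and [uz] rule out the empty set, which gains the last unit of the
   bound. *)
have e0 : 0 < edge_dim G.
  rewrite -cS card_gt0; apply: contraL HS => /eqP ->.
  apply/negP => /forall_inP/(_ _ (edge_in _ _ wu)).
  move=> /forall_inP/(_ _ (edge_in _ _ uz))/implyP.
  have neq : [set w; u] != [set u; z].
    apply/eqP => E; have : z \in [set w; u] by rewrite E set22.
    by rewrite !inE (negbTE zw) (negbTE zu).
  by move=> /(_ neq)/exists_inP[w0]; rewrite inE.
have := mixed_dim_le _ mix; rewrite cardsC1; lia.
Qed.

End Dimension.

(** * The lower bound: caterpillars *)

Section Caterpillar.
Variables (n L : nat) (L_gt0 : 0 < L) (L_ltn : L < n) (n_le2L : n <= L + L).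

(* Vertices [0 .. L] form the spine; vertex [L + i] is pendant at [i]. *)
Definition parent (a : nat) : nat := if a <= L then a.-1 else a - L.

(** [parent] fixes 0, so the positivity guards prevent a loop there. *)
Definition cat_adj : rel 'I_n := fun a b =>
  (0 < b) && (parent b == a) || (0 < a) && (parent a == b).

Lemma cat_adj_sym : symmetric cat_adj.
Proof. by move=> a b; rewrite /cat_adj orbC. Qed.

Lemma cat_adj_irr : irreflexive cat_adj.
Proof using L_gt0.
by move=> a; rewrite /cat_adj /parent; clear L_ltn n_le2L; case: ifP => aL; lia.
Qed.

Definition caterpillar : sgraph := @SGraph 'I_n cat_adj cat_adj_sym cat_adj_irr.

(** The two ends of the spine. As [n <= L + L], pendants hang only at 1, ..., [n - 1 - L], hence at
    neither end. *)
Let root : caterpillar := Ordinal (leq_ltn_trans (leq0n L) L_ltn).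
Let tip : caterpillar := Ordinal L_ltn.

Let to_root (a : 'I_n) : nat := if a <= L then a : nat else (a - L).+1.
Let to_tip (a : 'I_n) : nat := if a <= L then L - a else (L - (a - L)).+1.

Lemma cat_dist_root (a : caterpillar) :
  connect (@adj caterpillar) a root /\ dist a root = to_root a.
Proof.
apply: (@dist_of_descent caterpillar to_root) => [|x y|x xr] //.
  rewrite /= /cat_adj /parent /to_root; have := ltn_ord x; have := ltn_ord y.
  by do !case: ifP; lia.
have xlt : x < n := ltn_ord x; have x0 : 0 < x by rewrite lt0n.
have plt : parent x < n by rewrite /parent; case: ifP; lia.
exists (Ordinal plt : caterpillar); first by rewrite /= /cat_adj /= x0 eqxx orbT.
by rewrite /to_root /= /parent; do !case: ifP; lia.
Qed.

Lemma cat_dist_tip (a : caterpillar) : dist a tip = to_tip a.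
Proof.
apply: (proj2 (_ : connect (@adj caterpillar) a tip /\ _)).
apply: (@dist_of_descent caterpillar to_tip) => [|x y|x xr].
- by rewrite /to_tip /= leqnn subnn.
- rewrite /= /cat_adj /parent /to_tip; have := ltn_ord x; have := ltn_ord y.
  by do !case: ifP; lia.
have xlt : x < n := ltn_ord x; have xL : x != L :> nat := xr.
(* Towards the tip, move up the spine, or from a pendant to its foot. *)
have plt : (if x <= L then x.+1 else x - L) < n by case: ifP; lia.
exists (Ordinal plt : caterpillar).
  by rewrite /= /cat_adj /parent /=; do !case: ifP; lia.
by rewrite /to_tip /=; do !case: ifP; lia.
Qed.

Lemma caterpillar_connected : connected caterpillar.
Proof. by apply: (connected_of_root _ root) => a; case: (cat_dist_root a). Qed.

(** Orienting edges from parent to child lets the child [b] index the edge. *)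
Lemma cat_edgeP (e : {set caterpillar}) : e \in edges caterpillar ->
  exists a b : 'I_n, [/\ 0 < b, parent b = a, @adj caterpillar a b & e = [set a; b]].
Proof.
case/edgesP=> a [b [ab ->]]; case/orP: (ab) => /andP[b0 /eqP pb].
  by exists a, b.
by exists b, a; rewrite adj_sym setUC.
Qed.

Lemma cat_edge_dist (a b : caterpillar) : 0 < b -> parent b = a -> adj a b ->
  edist [set a; b] root = (if b <= L then b.-1 else b - L) /\
  edist [set a; b] tip = (if b <= L then L - b else L - (b - L)).
Proof.
move=> b0 pb ab; rewrite !edistE // !cat_dist_tip !(fun x => (cat_dist_root x).2).
rewrite /to_root /to_tip -pb /parent; have blt : b < n := ltn_ord b.
have [bL|bL] := leqP b L => /=.
  have -> : b.-1 <= L by lia.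
  by split; lia.
have -> : b - L <= L by lia.
by split; lia.
Qed.

(** The distances to the two ends add up to [L - 1] for a spine edge and to [L] for a pendant edge.
    The sum reveals the kind of edge, and the distance to [root] then its position. *)
Lemma caterpillar_edge_resolving : edge_resolving [set root; tip].
Proof.
apply/forall_inP=> e /cat_edgeP[a [b [b0 pb ab ->]]].
apply/forall_inP=> f /cat_edgeP[c [d [d0 pd cd ->]]].
apply/implyP; apply: contraNT; rewrite negb_exists_in => /forall_inP H.
have := H _ (set21 root tip); have := H _ (set22 root tip).
have [er et] := cat_edge_dist _ _ b0 pb ab; have [fr ft] := cat_edge_dist _ _ d0 pd cd.
rewrite /resolves /= er et fr ft !negbK => /eqP Ht /eqP Hr.
have bd : b = d.
  apply: val_inj => /=; have := ltn_ord b; have := ltn_ord d; move: Ht Hr.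
  by case: (leqP b L); case: (leqP d L); lia.
have ac : a = c by apply: val_inj; rewrite /= -pb -pd bd.
by rewrite ac bd.
Qed.

Lemma caterpillar_mixed_dim : (n - L).+1 <= mixed_dim caterpillar.
Proof.
have [S HS <-] := mixed_dim_witness caterpillar.
(* Enumeration of the leaves: index 0 is the root, 1 the tip, and [i >= 2] the pendant at
   [i - 1]. *)
have leaf_lt (i : 'I_(n - L).+1) : (if i == 0 :> nat then 0 else L + i - 1) < n.
  by have := ltn_ord i; case: ifP; lia.
pose leaf i : caterpillar := Ordinal (leaf_lt i).
have leaf_inj : injective leaf.
  move=> i j /(congr1 (fun x : 'I_n => nat_of_ord x)) /= E; apply: val_inj => /=.
  by move: E; do !case: ifP; lia.
rewrite -[leqLHS]card_ord -cardsT -(card_imset _ leaf_inj).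
apply/subset_leq_card/subsetP=> _ /imsetP[i _ ->].
have ilt := ltn_ord i.
(* The only neighbour of each leaf, in the same three cases. *)
have nb_lt : (if i == 0 :> nat then 1 else if i == 1 :> nat then L.-1 else i - 1) < n.
  by do !case: ifP; lia.
apply: (leaf_in_mixed_resolving _ _ _ (Ordinal nb_lt : caterpillar)) HS _ _.
- exact: caterpillar_connected.
- by rewrite /= /cat_adj /parent /=; do !case: ifP; lia.
move=> y; rewrite /= /cat_adj /parent /= => H; apply: val_inj => /=.
by move: H; have := ltn_ord y; do !case: ifP; lia.
Qed.

Lemma caterpillar_gap : n - L + edge_dim caterpillar <= mixed_dim caterpillar + 1.
Proof.
have := caterpillar_mixed_dim; have := edge_dim_le _ _ caterpillar_edge_resolving.
by rewrite cards2; case: (root != tip); lia.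
Qed.

End Caterpillar.

(** * Existence of the maximum, and both bounds *)

(** By excluded middle, a member that is not maximal has a larger one, nearer to [B]; induction on
    the distance to [B] ends this ascent. *)
Lemma int_max_exists (P : int -> Prop) (B : int) :
  (exists m, P m) -> (forall m, P m -> (m <= B)%R) ->
  exists2 m, P m & forall m', P m' -> (m' <= m)%R.
Proof.
move=> [m Pm] bound; have [k] := ubnP `|(B - m)%R|%N.
elim: k m Pm => // k IH m Pm lek.
have [[m' [Pm' ltm]]|nex] := classic (exists m', P m' /\ (m < m')%R).
  by apply: (IH m' Pm'); have := bound _ Pm'; lia.
exists m => // m' Pm'; apply: contraT => nle.
by case: nex; exists m'; split=> //; lia.
Qed.

Theorem theorem1 (n : nat) (hn : 4 <= n) :
  exists m : int,
    is_max_dim_gap n m /\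
    ((n %/ 2)%:Z - 1 <= m)%R /\ (m <= n%:Z - 2)%R.
Proof.
pose P m := exists G : sgraph, [/\ #|G| = n, connected G & dim_gap G = m].
have bound m : P m -> (m <= n%:Z - 2)%R.
  case=> G [cG Gc <-]; have := dim_gap_upper G Gc.
  by rewrite cG /dim_gap => /(_ ltac:(lia)); lia.
(* Rounding up half of [n] gives [n <= L + L], and [n - L] is exactly the floor wanted in the
   bound. *)
pose L := n - n %/ 2.
have [L_gt0 L_ltn n_le2L] : [/\ 0 < L, L < n & n <= L + L] by split; rewrite /L; lia.
have catP : P (dim_gap (caterpillar n L L_gt0)).
  exists (caterpillar n L L_gt0); split; rewrite ?card_ord //.
  exact: caterpillar_connected.
have [m Pm maxm] := int_max_exists P _ (ex_intro _ _ catP) bound.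
exists m; split; [split=> // G cG Gc; apply: maxm; by exists G|split; last exact: bound].
have := maxm _ catP; have := caterpillar_gap n L L_gt0 L_ltn n_le2L.
by rewrite /dim_gap /L; lia.
Qed.
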